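(* For the graph $G'$, we have $ecvc(G')=cvc(G')$, and any sequence of attacks can be defended by using only configurations of Type B, Type C, Type D and Type E.
   Context: The graph $G$ has 32 vertices, $V=A\cup C\cup P\cup Q\cup R\cup Z\cup U$ (disjoint union), where $A=\{a_1,a_2,a_3\}$, $C=\{c_1,c_2,c_3\}$, $Q=\{q_1,q_2,q_3\}$, $R=\{r_1,r_2,r_3\}$, $Z=\{z_0,z_{12},z_{23},z_{13}\}$, $U=\{u_0,u_{12},u_{23},u_{13}\}$, and $P$ consists of 12 private vertices, two for each of the six support vertices (the vertices of $A\cup C$). Its edges are exactly: each support vertex is adjacent to its own two private vertices (its private neighbors), and these two are adjacent to each other; for each $i\in\{1,2,3\}$ both $a_i$ and $c_i$ are adjacent to both $q_i$ and $r_i$; for $1\le i<j\le 3$, $z_{ij}$ is adjacent to $a_i,a_j,q_i,q_j$ and $u_{ij}$ is adjacent to $c_i,c_j,r_i,r_j$; $z_0$ is adjacent to $q_1,q_2,a_1$; $u_0$ is adjacent to $r_1,r_2,c_1$. The graph $G'$ is obtained from $G$ by deleting the single edge $q_1z_{13}$. Put $Z'=\{q_1,q_2,z_{13},z_{23}\}$, $U'=\{r_1,r_2,u_{13},u_{23}\}$, $Z_1=\{z_0,z_{12},z_{23},q_3\}$. A set of vertices is of Type B, C, D, E respectively if it consists of exactly one private neighbor of each support vertex together with, respectively: $A\cup C\cup R\cup Z'$; $A\cup C\cup Q\cup U$; $A\cup C\cup Q\cup U'$; $A\cup C\cup R\cup Z_1$. A connected vertex cover of a graph is a set of vertices that meets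 every edge and induces a connected subgraph; $cvc$ is the minimum size of a connected vertex cover. Eternal Connected Vertex Cover game with $k$ guards on a connected graph: the defender first chooses a set of $k$ vertices and places one guard on each; this set must be a connected vertex cover. In each round the attacker attacks an edge. The defender responds by moving guards simultaneously: each guard stays put or moves to a neighbouring vertex, at least one guard must move across the attacked edge (from one endpoint to the other; guards on both endpoints may exchange positions), and after the movement at most one guard occupies each vertex. The set of occupied vertices (the configuration) must be a connected vertex cover after every response; otherwise (or if no legal response exists) the attacker wins. $ecvc$ is the least $k$ such that the defender with $k$ guards can defend every infinite sequence of attacks. *)

(* Defs.v *)
From HB Require Import structures.
From mathcomp Require Import all_boot.

Set Implicit Arguments.
Unset Strict Implicit.
Unset Printing Implicit Defensive.

(* A finite simple graph is a symmetric irreflexive [e : rel T] on a finType. *)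

Definition vertex_cover (T : finType) (e : rel T) (S : {set T}) : bool :=
  [forall x, forall y, e x y ==> (x \in S) || (y \in S)].

Definition induced (T : finType) (e : rel T) (S : {set T}) : rel T :=
  [rel x y | [&& x \in S, y \in S & e x y]].

(* The empty set counts as connected; it covers no graph that has an edge. *)
Definition connected_set (T : finType) (e : rel T) (S : {set T}) : bool :=
  [forall x in S, forall y in S, connect (induced e S) x y].

Definition connected_vertex_cover (T : finType) (e : rel T) (S : {set T}) :=
  vertex_cover e S && connected_set e S.

(* "cvc = k" *)
Definition is_cvc (T : finType) (e : rel T) (k : nat) : Prop :=
  (exists S : {set T}, connected_vertex_cover e S /\ #|S| = k) /\
  (forall S : {set T}, connected_vertex_cover e S -> k <= #|S|).

(* [m x] is the vertex to which the guard standing on [x \in S] moves.  An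
   attacked edge xy is the pair (x, y), in either orientation. *)
Definition legal_response (T : finType) (e : rel T)
    (S : {set T}) (xy : T * T) (S' : {set T}) : Prop :=
  exists m : T -> T,
    [/\ forall x, x \in S -> m x = x \/ e x (m x),
        {in S &, injective m},
        [set m x | x in S] = S'
      & (xy.1 \in S /\ m xy.1 = xy.2) \/ (xy.2 \in S /\ m xy.2 = xy.1)].

(* A strategy maps the attacks made so far, oldest first, to the resulting
   configuration; its value at [::] is the initial placement. *)
Definition strategy (T : finType) := seq (T * T) -> {set T}.

Definition attack_sequence (T : finType) (e : rel T) (att : nat -> T * T) :=
  forall n, e (att n).1 (att n).2.

(* [s] is a winning defender strategy with [k] guards all of whose
   configurations belong to [F]. *)
Definition defends_within (T : finType) (e : rel T) (k : nat)
    (F : pred {set T}) (s : strategy T) : Prop :=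
  let valid (S : {set T}) := [/\ #|S| = k, connected_vertex_cover e S & F S] in
  valid (s [::]) /\
  forall att : nat -> T * T, attack_sequence e att ->
  forall n, legal_response e (s (mkseq att n)) (att n) (s (mkseq att n.+1)) /\
            valid (s (mkseq att n.+1)).

Definition defensible_within (T : finType) (e : rel T) (k : nat)
    (F : pred {set T}) : Prop :=
  exists s : strategy T, defends_within e k F s.

Definition defensible (T : finType) (e : rel T) (k : nat) : Prop :=
  defensible_within e k predT.

(* "ecvc = k" *)
Definition is_ecvc (T : finType) (e : rel T) (k : nat) : Prop :=
  defensible e k /\ (forall k', defensible e k' -> k <= k').

Definition delete_edge (T : finType) (e : rel T) (u v : T) : rel T :=
  [rel x y | [&& e x y, (x, y) != (u, v) & (x, y) != (v, u)]].

Lemma delete_edge_sym (T : finType) (e : rel T) (u v : T) :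
  symmetric e -> symmetric (delete_edge e u v).
Proof.
move=> e_sym x y; rewrite /delete_edge /= e_sym !xpair_eqE.
by rewrite (andbC (y == u)) (andbC (y == v)) [X in _ = _ && X]andbC.
Qed.

Lemma delete_edge_irr (T : finType) (e : rel T) (u v : T) :
  irreflexive e -> irreflexive (delete_edge e u v).
Proof. by move=> e_irr x; rewrite /delete_edge /= e_irr. Qed.

Inductive idx := I1 | I2 | I3.

Definition idx_enc (i : idx) : option bool :=
  match i with I1 => None | I2 => Some false | I3 => Some true end.
Definition idx_dec (o : option bool) : idx :=
  match o with None => I1 | Some false => I2 | Some true => I3 end.
Lemma idx_encK : cancel idx_enc idx_dec. Proof. by case. Qed.
HB.instance Definition _ := Countable.copy idx (can_type idx_encK).
HB.instance Definition _ : isFinite idx := CanIsFinite idx_encK.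

(* The subscripts of the z's and u's. *)
Inductive lab := L0 | L12 | L23 | L13.

Definition lab_enc (l : lab) : bool * bool :=
  match l with
  | L0 => (false, false) | L12 => (false, true)
  | L23 => (true, false) | L13 => (true, true)
  end.
Definition lab_dec (b : bool * bool) : lab :=
  match b with
  | (false, false) => L0 | (false, true) => L12
  | (true, false) => L23 | (true, true) => L13
  end.
Lemma lab_encK : cancel lab_enc lab_dec. Proof. by case. Qed.
HB.instance Definition _ := Countable.copy lab (can_type lab_encK).
HB.instance Definition _ : isFinite lab := CanIsFinite lab_encK.

(* [pa_ i b] and [pc_ i b], for b : bool, are the two private neighbours of
   the support vertices [a_ i] and [c_ i]. *)
Inductive vertex :=
  | a_ of idx | c_ of idx | q_ of idx | r_ of idx
  | z_ of lab | u_ of lab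
  | pa_ of idx & bool | pc_ of idx & bool.

Definition vertex_code : Type :=
  (((idx + idx) + (idx + idx)) + ((lab + lab) + (idx * bool + idx * bool)))%type.
Definition vertex_enc (v : vertex) : vertex_code :=
  match v with
  | a_ i => inl (inl (inl i)) | c_ i => inl (inl (inr i))
  | q_ i => inl (inr (inl i)) | r_ i => inl (inr (inr i))
  | z_ l => inr (inl (inl l)) | u_ l => inr (inl (inr l))
  | pa_ i b => inr (inr (inl (i, b))) | pc_ i b => inr (inr (inr (i, b)))
  end.
Definition vertex_dec (v : vertex_code) : vertex :=
  match v with
  | inl (inl (inl i)) => a_ i | inl (inl (inr i)) => c_ i
  | inl (inr (inl i)) => q_ i | inl (inr (inr i)) => r_ i
  | inr (inl (inl l)) => z_ l | inr (inl (inr l)) => u_ l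
  | inr (inr (inl (i, b))) => pa_ i b | inr (inr (inr (i, b))) => pc_ i b
  end.
Lemma vertex_encK : cancel vertex_enc vertex_dec. Proof. by case. Qed.
HB.instance Definition _ := Countable.copy vertex (can_type vertex_encK).
HB.instance Definition _ : isFinite vertex := CanIsFinite vertex_encK.

(* The i such that z_l is adjacent to a_i, equivalently u_l to c_i. *)
Definition support_idx (l : lab) : seq idx :=
  match l with
  | L0 => [:: I1]
  | L12 => [:: I1; I2] | L23 => [:: I2; I3] | L13 => [:: I1; I3]
  end.

(* The i such that z_l is adjacent to q_i, equivalently u_l to r_i. *)
Definition inner_idx (l : lab) : seq idx :=
  match l with
  | L0 => [:: I1; I2]
  | L12 => [:: I1; I2] | L23 => [:: I2; I3] | L13 => [:: I1; I3]
  end.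

Definition half_edge (x y : vertex) : bool :=
  match x, y with
  | a_ i, pa_ j _ => i == j
  | c_ i, pc_ j _ => i == j
  | pa_ i b, pa_ j b' => (i == j) && (b != b')
  | pc_ i b, pc_ j b' => (i == j) && (b != b')
  | a_ i, q_ j | a_ i, r_ j | c_ i, q_ j | c_ i, r_ j => i == j
  | z_ l, a_ i | u_ l, c_ i => i \in support_idx l
  | z_ l, q_ i | u_ l, r_ i => i \in inner_idx l
  | _, _ => false
  end.

Definition G : rel vertex := [rel x y | half_edge x y || half_edge y x].

Definition G' : rel vertex := delete_edge G (q_ I1) (z_ L13).

Lemma G_sym : symmetric G.
Proof. by move=> x y; rewrite /G /= orbC. Qed.

Lemma G_irr : irreflexive G.
Proof. by do 2!case=> //; case. Qed.

Lemma G'_sym : symmetric G'.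
Proof. exact: delete_edge_sym G_sym. Qed.

Lemma G'_irr : irreflexive G'.
Proof. exact: delete_edge_irr G_irr. Qed.

Definition A : {set vertex} := [set a_ i | i : idx].
Definition C : {set vertex} := [set c_ i | i : idx].
Definition Q : {set vertex} := [set q_ i | i : idx].
Definition R : {set vertex} := [set r_ i | i : idx].
Definition U : {set vertex} := [set u_ l | l : lab].
Definition Z' : {set vertex} := [set q_ I1; q_ I2; z_ L13; z_ L23].
Definition U' : {set vertex} := [set r_ I1; r_ I2; u_ L13; u_ L23].
Definition Z1 : {set vertex} := [set z_ L0; z_ L12; z_ L23; q_ I3].

(* The private neighbours of a support vertex; set0 on other vertices. *)
Definition private (x : vertex) : {set vertex} :=
  match x with
  | a_ i => [set pa_ i b | b : bool]
  | c_ i => [set pc_ i b | b : bool]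
  | _ => set0
  end.

Definition P : {set vertex} := \bigcup_(x in A :|: C) private x.

(* [S] consists of exactly one private neighbour of each support vertex
   together with [W] (which is disjoint from P in all uses). *)
Definition privates_and (W S : {set vertex}) : bool :=
  (S :\: P == W) && [forall x in A :|: C, #|S :&: private x| == 1].

Definition typeB : pred {set vertex} := privates_and (A :|: C :|: R :|: Z').
Definition typeC : pred {set vertex} := privates_and (A :|: C :|: Q :|: U).
Definition typeD : pred {set vertex} := privates_and (A :|: C :|: Q :|: U').
Definition typeE : pred {set vertex} := privates_and (A :|: C :|: R :|: Z1).

Definition typeBCDE : pred {set vertex} :=
  [pred S | [|| typeB S, typeC S, typeD S | typeE S]].

(* Main.v *)
Require Import Defs.
From mathcomp Require Import all_boot.

Set Implicit Arguments.
Unset Strict Implicit.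
Unset Printing Implicit Defensive.

(**
  The common value is 19. Call Q, Z the left side of the graph and R, U its
  right side; no edge joins the two sides, they only meet through the support
  vertices.

  Lower bound ([cvc_ge]). A connected vertex cover S contains every support
  vertex, since otherwise a private neighbour in S would be cut off
  ([supports_sub]); with one vertex from each private pair this accounts for
  12 vertices. On each side the edges contain a matching of size 3, so S has
  at least 3 vertices there, and if S omits one of the q_i, respectively r_i,
  then the neighbours it is forced to contain raise this to 4. So 18 vertices
  would leave no room beyond the q_i and the r_i; but then nothing
  connects the three strands {a_i, c_i, q_i, r_i} ([meets_ZU]). All these
  counts are instances of one remark: S has at least as many elements as any
  family of disjoint sets that it meets ([leq_packing_card]).

  Strategy. A configuration of one of the four types is given by its type and
  by the choice of a private neighbour for each support vertex. It is a
  connected vertex cover with 19 vertices ([card_conf], [conf_cover],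
  [conf_connected]). In types B and E the right side carries just R while
  the left side has 4 guards, which link the strands; in C and D the roles
  of the sides are exchanged. It remains to answer one attack from an
  arbitrary such configuration ([respond]). Two guards at the ends of the
  attacked edge exchange their positions ([legal_swap]). When the unoccupied
  end is private, at most two guards shift towards it and the type stays the
  same ([respond_private]). Every other attack is answered by a change of type
  in which the 6 guards on private vertices do not move, while others advance
  along disjoint walks that end on the vertices to be occupied. A short list
  of such plans suffices, also because a plan run backwards answers attacks on
  the configuration it leads to ([responses_carry], [responses_answer]).
*)

(** * Finite graphs *)

Section Graphs.
Variables (T : finType) (e : rel T).
Implicit Types (S K : {set T}) (x y : T).

(** A lower bound for covers by duality: the blocks of a packing are disjoint,
    so [S] spends a different element on each of them. *)
Lemma leq_packing_card (bs : seq (seq T)) S :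
  uniq (flatten bs) -> all (has [in S]) bs -> size bs <= #|S|.
Proof.
move=> uniq_bs meets.
have le_count: size bs <= count [in S] (flatten bs).
  elim: bs meets {uniq_bs} => //= b bs IHbs /andP[meet_b /IHbs le_bs].
  by rewrite count_cat -add1n leq_add // -has_count.
apply: leq_trans le_count _; rewrite -size_filter cardE.
apply: uniq_leq_size; first exact: filter_uniq.
by move=> x; rewrite mem_filter mem_enum => /andP[].
Qed.

(** A set closed under the edges of [S] contains the component in [S] of each
    of its vertices, so connectivity of [S] makes it all of [S]. Each use
    derives a contradiction from a set [K] that is too small. *)
Lemma connected_set_sub S K x :
  connected_set e S -> x \in S -> x \in K ->
  {in S &, forall u v, e u v -> u \in K -> v \in K} -> S \subset K.
Proof.
move=> /forall_inP connS Sx Kx closedK; apply/subsetP => y Sy.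
have /connectP[p] := forall_inP (connS x Sx) y Sy.
elim: p x Kx {Sx} => [|z p IHp] x Kx /= => [_ -> //|].
by case/andP=> /and3P[Sx Sz exz] /IHp; apply; apply: closedK exz Kx.
Qed.

(** Read from its end, such a sequence builds a tree: each vertex comes with a
    neighbour that is already there. This turns the connectivity of an explicit
    set into a computation. *)
Fixpoint grown (s : seq T) : bool :=
  if s is x :: s' then (nilp s' || has (e x) s') && grown s' else true.

Lemma grown_connected (s : seq T) :
  symmetric e -> grown s -> connected_set e [set x in s].
Proof.
move=> e_sym grown_s; set S := [set x in s].
have S_sym: connect_sym (induced e S).
  by apply: sym_connect_sym => x y; rewrite /induced /= e_sym andbCA.
suff conn t: grown t -> {subset t <= S} ->
    {in t &, forall x y, connect (induced e S) x y}.
  rewrite /connected_set; apply/forall_inP=> x Sx; apply/forall_inP=> y Sy.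
  by rewrite !inE in Sx Sy; apply: (conn s) => // z; rewrite inE.
elim: t {grown_s} => //= x t IHt /andP[adj_x /IHt conn_t] sub_t.
have sub_t' : {subset t <= S}.
  by move=> z tz; apply: sub_t; rewrite inE tz orbT.
have conn_x y: y \in t -> connect (induced e S) x y.
  move=> ty; case/orP: adj_x => [/nilP t0|/hasP[z tz exz]].
    by rewrite t0 in ty.
  apply: connect_trans (conn_t sub_t' z y tz ty); apply: connect1.
  by rewrite /induced /= exz (sub_t' z tz) (sub_t x) ?mem_head.
move=> y z; rewrite !inE => /predU1P[->|ty] /predU1P[->|tz] //.
- exact: conn_x.
- by rewrite S_sym conn_x.
exact: conn_t.
Qed.

(** * Responses and strategies *)

Lemma legal_response_sym S x y S' :
  legal_response e S (x, y) S' -> legal_response e S (y, x) S'.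
Proof. by case=> m [? ? ? /=] /or_comm ?; exists m. Qed.

(** Injectivity of the move is automatic, because the new configuration has as
    many vertices as there are guards. *)
Lemma legal_of_image (m : T -> T) S x S' :
  {in S, forall z, m z = z \/ e z (m z)} -> m @: S = S' -> #|S'| = #|S| ->
  x \in S -> legal_response e S (x, m x) S'.
Proof.
move=> moves imS cardS Sx; exists m; split=> //; last by left.
by apply/imset_injP; rewrite imS cardS.
Qed.

Lemma legal_swap S x y :
  symmetric e -> x \in S -> y \in S -> e x y -> legal_response e S (x, y) S.
Proof.
move=> e_sym Sx Sy exy.
pose m z := if z == x then y else if z == y then x else z.
have mS z: z \in S -> m z \in S by rewrite /m; do 2![case: eqP => // _].
have mK: involutive m.
  move=> z; rewrite /m; case: (eqVneq z x) => [->|zx].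
    by case: (eqVneq y x) => [-> //|]; rewrite eqxx.
  by case: (eqVneq z y) => [->|zy]; rewrite ?eqxx // (negPf zx) (negPf zy).
have mx: m x = y by rewrite /m eqxx.
rewrite -[y in (x, y)]mx; apply: legal_of_image => // [z _|].
  rewrite /m; case: (eqVneq z x) => [->|_]; first by right.
  by case: (eqVneq z y) => [->|_]; [right; rewrite e_sym | left].
apply/setP=> z; apply/imsetP/idP => [[w Sw ->]|Sz]; first exact: mS.
by exists (m z); rewrite ?mK ?mS.
Qed.

(** The guard on [x] crosses to [y] and the one on [w] takes the vacated place;
    for [w = x] a single guard moves. *)
Lemma legal_push S x y w :
  w \in S -> x \in S -> y \notin S -> w = x \/ e w x -> e x y ->
  legal_response e S (x, y) (y |: S :\ w).
Proof.
move=> Sw Sx S'y ewx exy.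
pose m z := if z == x then y else if z == w then x else z.
have mx: m x = y by rewrite /m eqxx.
have mw: w != x -> m w = x by move=> wx; rewrite /m (negPf wx) eqxx.
have mz z: z != x -> z != w -> m z = z.
  by move=> zx zw; rewrite /m (negPf zx) (negPf zw).
rewrite -[y in (x, y)]mx; apply: legal_of_image => //.
- move=> z _; case: (eqVneq z x) => [->|zx]; first by right; rewrite mx.
  case: (eqVneq z w) zx => [-> wx|zw zx]; last by left; rewrite mz.
  by right; rewrite mw //; case: ewx => // /eqP; rewrite (negPf wx).
- apply/setP=> z; rewrite !inE; apply/imsetP/idP => [[u Su ->]|].
    case: (eqVneq u x) => [->|ux]; first by rewrite mx eqxx.
    case: (eqVneq u w) ux => [-> wx|uw ux]; last by rewrite mz // uw Su orbT.
    by rewrite mw // (eq_sym x w) wx Sx orbT.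
  case/predU1P=> [->|/andP[zw Sz]]; first by exists x.
  case: (eqVneq z x) => [zx|zx]; last by exists z; rewrite ?mz.
  by exists w; rewrite // mw -?zx // eq_sym.
by rewrite cardsU1 (cardsD1 w S) Sw !inE (negPf S'y) andbF.
Qed.

(** A plan is a list of disjoint walks; on each of them all the guards advance
    by one vertex at the same time, the last vertex of the walk being free.
    Its [arcs] are the single moves, and [relocate] looks up
    the move of a guard, vertices that start no arc being fixed. *)
Definition arcs (ws : seq (seq T)) : seq (T * T) :=
  flatten [seq zip w (behead w) | w <- ws].

Definition relocate (ws : seq (seq T)) (x : T) : T :=
  nth x (unzip2 (arcs ws)) (index x (unzip1 (arcs ws))).

(** The plan [ws] moves guards from [s] onto [s'] only along edges. As the
    arcs start in [s], guards standing outside [s] are left in place. *)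
Definition carries (s : seq T) (ws : seq (seq T)) (s' : seq T) : bool :=
  [&& all (fun a => e a.1 a.2) (arcs ws),
      all (mem s) (unzip1 (arcs ws))
    & perm_eq (map (relocate ws) s) s'].

Lemma relocate_id ws x : x \notin unzip1 (arcs ws) -> relocate ws x = x.
Proof.
by move=> x'ws; rewrite /relocate nth_default // memNindex // !size_map.
Qed.

Lemma relocate_edge ws x :
  all (fun a => e a.1 a.2) (arcs ws) ->
  relocate ws x = x \/ e x (relocate ws x).
Proof.
move=> /allP edges.
case: (boolP (x \in unzip1 (arcs ws))) => [xws|]; last first.
  by move=> /relocate_id; left.
have lt_i: index x (unzip1 (arcs ws)) < size (arcs ws).
  by rewrite -(size_map fst) index_mem.
right; have := edges _ (mem_nth (x, x) lt_i).
by rewrite -!(nth_map _ x) // nth_index.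
Qed.

Lemma legal_walks (idle s s' : seq T) ws x :
  uniq (idle ++ s) -> uniq (idle ++ s') -> carries s ws s' -> x \in s ->
  legal_response e [set z in idle ++ s] (x, relocate ws x)
                   [set z in idle ++ s'].
Proof.
move=> uniq_s uniq_s' /and3P[edges /allP sources perm_s] sx.
have map_s: perm_eq (map (relocate ws) (idle ++ s)) (idle ++ s').
  rewrite map_cat; apply: perm_cat perm_s.
  suff /eq_in_map-> : {in idle, relocate ws =1 id} by rewrite map_id.
  move=> z idle_z; apply: relocate_id; apply: contraTN uniq_s => /sources sz.
  by rewrite cat_uniq; apply/and3P=> [[_ /hasPn/(_ z sz)/negP]].
apply: legal_of_image => [z _||| ].
- exact: relocate_edge.
- apply/setP=> z; rewrite inE -(perm_mem map_s).
  apply/imsetP/mapP=> -[u su ->]; exists u => //.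
    by rewrite inE in su.
  by rewrite inE.
- by rewrite !cardsE !(card_uniqP _) // -(perm_size map_s) size_map.
by rewrite inE mem_cat sx orbT.
Qed.

(** A family of safe configurations that can answer each single attack within
    itself yields a strategy with memory: fold the answers along the history.
    The answers are given as a sigma type, so that no choice is involved. *)
Lemma defensible_within_states (I : Type) (conf : I -> {set T}) (i0 : I)
    (k : nat) (F : pred {set T}) :
  (forall i, [/\ #|conf i| = k, connected_vertex_cover e (conf i)
               & F (conf i)]) ->
  (forall i x y, e x y -> {j | legal_response e (conf i) (x, y) (conf j)}) ->
  defensible_within e k F.
Proof.
move=> valid respond.
pose next i xy := if boolP (e xy.1 xy.2) is AltTrue exy
                  then sval (respond i _ _ exy) else i.
exists (fun h => conf (foldl next i0 h)).
split=> [|att edges n]; first exact: valid.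
split; last exact: valid.
rewrite mkseqS foldl_rcons /next.
case: {-}_ / boolP => [exy|]; last by rewrite edges.
by case: (respond _ _ _ exy) => j; case: (att n).
Qed.

End Graphs.

(** * The lower bound *)

Definition supports : seq vertex :=
  [:: a_ I1; a_ I2; a_ I3; c_ I1; c_ I2; c_ I3].

Lemma mem_private v s :
  (v \in private s) = match v with
    pa_ i _ => s == a_ i | pc_ i _ => s == c_ i | _ => false end.
Proof.
case: s => i; rewrite /private ?inE; try by case: v.
- by apply/imsetP/idP => [[b _ ->]//|]; case: v => // j b /eqP[->]; exists b.
- by apply/imsetP/idP => [[b _ ->]//|]; case: v => // j b /eqP[->]; exists b.
Qed.

Lemma G'_private s u v :
  u \in private s -> G' u v -> v = s \/ v \in private s.
Proof.
rewrite !mem_private; case: u => // i b /eqP-> /and3P[+ _ _].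
- case: v => [j|j|j|j|j|j|j b'|j b']; rewrite /G /= ?orbF //.
    by move=> /eqP->; left.
  by case/orP=> /andP[/eqP-> _]; right.
- case: v => [j|j|j|j|j|j|j b'|j b']; rewrite /G /= ?orbF //.
    by move=> /eqP->; left.
  by case/orP=> /andP[/eqP-> _]; right.
Qed.

Definition labs : seq lab := [:: L0; L12; L23; L13].

(** Without the vertices of Z and U, the graph falls apart into three pieces,
    numbered by the subscripts. *)
Definition strand (v : vertex) : option idx :=
  match v with
  | a_ i | c_ i | q_ i | r_ i | pa_ i _ | pc_ i _ => Some i
  | z_ _ | u_ _ => None
  end.

Lemma strand_edge u v :
  strand u != None -> strand v != None -> G' u v -> strand u = strand v.
Proof.
move=> + + /and3P[uv _ _]; move: uv.
case: u => [i|i|i|i|i|i|i b|i b] //; case: v => [j|j|j|j|j|j|j b'|j b'] //;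
  rewrite /G /= ?orbF //; try by move=> /eqP->.
- by case/orP=> /andP[/eqP->].
- by case/orP=> /andP[/eqP->].
Qed.

Section LowerBound.
Variable S : {set vertex}.
Hypothesis cvcS : connected_vertex_cover G' S.

Lemma cover u v : G' u v -> (u \in S) || (v \in S).
Proof.
by have /andP[/forallP/(_ u)/forallP/(_ v)/implyP covS _] := cvcS; apply: covS.
Qed.

Definition private_seq (s : vertex) : seq vertex :=
  match s with
  | a_ i => [:: pa_ i false; pa_ i true]
  | c_ i => [:: pc_ i false; pc_ i true]
  | _ => [::]
  end.

Lemma private_seq_met s : s \in supports -> has [in S] (private_seq s).
Proof.
rewrite !inE => s_supp; suff [i [->|->]]: exists i, s = a_ i \/ s = c_ i.
- by rewrite /= orbF; apply: cover; case: i.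
- by rewrite /= orbF; apply: cover; case: i.
by case/or4P: s_supp => [|||/or3P[]] /eqP->; eexists; by [left|right].
Qed.

Lemma private_met s : s \in supports -> exists2 p, p \in S & p \in private s.
Proof.
move=> /private_seq_met/hasP[p p_s Sp]; exists p => //.
by case: s p_s => // i; rewrite !inE mem_private => /orP[] /eqP->.
Qed.

(** If [s] is missing then its private neighbours in [S], of which there is at
    least one, have no neighbour in [S] outside their pair, although [S] also
    meets the private pair of another support vertex. *)
Lemma supports_sub s : s \in supports -> s \in S.
Proof.
move=> s_supp; apply: contraT => S's.
pose s' := if s is a_ _ then c_ I1 else a_ I1.
have [p Sp sp] := private_met s_supp.
have [p' Sp' sp']: exists2 p, p \in S & p \in private s'.
  by apply: private_met; rewrite /s'; case: (s).
have /andP[_ connS] := cvcS.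
have /subsetP/(_ p' Sp') : S \subset private s.
  apply: connected_set_sub connS Sp sp _ => u v _ Sv uv su.
  by case: (G'_private su uv) => // Ev; rewrite -Ev Sv in S's.
move: sp'; rewrite !mem_private /s'.
by case: (s) s_supp p' {Sp'} => // i _ [] // j b /eqP[->] // /eqP.
Qed.

(** Otherwise the strand of [a_ I1], closed under the edges inside [S], would
    contain [a_ I2]. *)
Lemma meets_ZU :
  has [in S] ([seq z_ l | l <- labs] ++ [seq u_ l | l <- labs]).
Proof.
apply: contraT => /hasPn no_zu.
have Sa i: a_ i \in S by apply: supports_sub; case: i.
have strandS v: v \in S -> strand v != None.
  move=> Sv; apply: contraL Sv => strand_v; apply: no_zu.
  by case: v strand_v => // -[].
have /andP[_ connS] := cvcS.
suff /subsetP/(_ _ (Sa I2)): S \subset [set v | strand v == Some I1].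
  by rewrite inE.
apply: connected_set_sub connS (Sa I1) _ _; first by rewrite inE.
move=> u v Su Sv uv; rewrite !inE => /eqP <-.
by rewrite eq_sym (strand_edge _ _ uv) ?strandS.
Qed.

(** The support vertices and the private pairs give 12 blocks; each case of
    the proof exhibits 7 more on the two sides. *)
Lemma cvc_ge : 19 <= #|S|.
Proof.
pose base := [seq [:: s] | s <- supports]
               ++ [seq private_seq s | s <- supports].
have base_met: all (has [in S]) base.
  rewrite all_cat !all_map; apply/andP; split; apply/allP=> s s_supp /=.
    by rewrite supports_sub.
  exact: private_seq_met.
have pack bs bs' : all (has [in S]) bs' -> all (has [in S]) bs ->
    size (bs' ++ bs) = 7 -> uniq (flatten (base ++ bs' ++ bs)) -> 19 <= #|S|.
  move=> met' met size_bs uniq_bs.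
  have ->: 19 = size (base ++ bs' ++ bs) by rewrite size_cat size_bs.
  by apply: leq_packing_card; rewrite // all_cat base_met all_cat met'.
have forced u v : u \notin S -> G' u v -> v \in S.
  by move=> S'u /cover; rewrite (negPf S'u).
have matchQ : all (has [in S])
    [:: [:: q_ I1; z_ L0]; [:: q_ I2; z_ L12]; [:: q_ I3; z_ L23]].
  by rewrite /= !orbF !cover.
have matchR : all (has [in S])
    [:: [:: r_ I1; u_ L0]; [:: r_ I2; u_ L12]; [:: r_ I3; u_ L23]].
  by rewrite /= !orbF !cover.
(* The sides are not quite symmetric: z_13 is not forced when q_1 is missing,
   but the edge from q_3 to z_13 supplies the fourth block. *)
have [Sq1|S'q1] := boolP (q_ I1 \in S); last first.
  apply: (pack [:: [:: z_ L0]; [:: z_ L12]; [:: q_ I2; z_ L23];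
                   [:: q_ I3; z_ L13]] _ matchR) => //.
  rewrite /= !orbF (forced _ (z_ L0) S'q1) // (forced _ (z_ L12) S'q1) //.
  by rewrite !cover.
have [Sq2|S'q2] := boolP (q_ I2 \in S); last first.
  apply: (pack [:: [:: q_ I1]; [:: z_ L0]; [:: z_ L12]; [:: z_ L23]]
            _ matchR) => //.
  by rewrite /= !orbF Sq1 !(forced _ _ S'q2).
have [Sq3|S'q3] := boolP (q_ I3 \in S); last first.
  apply: (pack [:: [:: q_ I1]; [:: q_ I2]; [:: z_ L13]; [:: z_ L23]]
            _ matchR) => //.
  by rewrite /= !orbF Sq1 Sq2 !(forced _ _ S'q3).
have [Sr1|S'r1] := boolP (r_ I1 \in S); last first.
  apply: (pack [:: [:: u_ L0]; [:: u_ L12]; [:: u_ L13]; [:: r_ I2; u_ L23]]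
            _ matchQ) => //.
  rewrite /= !orbF (forced _ (u_ L0) S'r1) // (forced _ (u_ L12) S'r1) //.
  by rewrite (forced _ (u_ L13) S'r1) // !cover.
have [Sr2|S'r2] := boolP (r_ I2 \in S); last first.
  apply: (pack [:: [:: r_ I1]; [:: u_ L0]; [:: u_ L12]; [:: u_ L23]]
            _ matchQ) => //.
  by rewrite /= !orbF Sr1 !(forced _ _ S'r2).
have [Sr3|S'r3] := boolP (r_ I3 \in S); last first.
  apply: (pack [:: [:: r_ I1]; [:: r_ I2]; [:: u_ L13]; [:: u_ L23]]
            _ matchQ) => //.
  by rewrite /= !orbF Sr1 Sr2 !(forced _ _ S'r3).
apply: (pack [:: [seq z_ l | l <- labs] ++ [seq u_ l | l <- labs]]
             [:: [:: q_ I1]; [:: q_ I2]; [:: q_ I3];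
                 [:: r_ I1]; [:: r_ I2]; [:: r_ I3]]) => //.
  by rewrite /= Sq1 Sq2 Sq3 Sr1 Sr2 Sr3.
by rewrite all_seq1 meets_ZU.
Qed.

End LowerBound.

(** * The four families of configurations *)

Inductive kind := KindB | KindC | KindD | KindE.

Definition kinds : seq kind := [:: KindB; KindC; KindD; KindE].

(** The non-private vertices of a configuration, listed in an order for which
    [grown] holds. *)
Definition core (k : kind) : seq vertex :=
  match k with
  | KindB => [:: c_ I1; c_ I2; c_ I3; r_ I1; r_ I2; r_ I3; q_ I1; q_ I2;
                 a_ I1; a_ I2; z_ L13; z_ L23; a_ I3]
  | KindC => [:: a_ I1; a_ I2; a_ I3; q_ I1; q_ I2; q_ I3; u_ L0; u_ L13;
                 c_ I1; u_ L12; c_ I2; u_ L23; c_ I3]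
  | KindD => [:: a_ I1; a_ I2; a_ I3; q_ I1; q_ I2; q_ I3; r_ I1; r_ I2;
                 c_ I1; c_ I2; u_ L13; u_ L23; c_ I3]
  | KindE => [:: c_ I1; c_ I2; c_ I3; r_ I1; r_ I2; r_ I3; q_ I3; z_ L0;
                 a_ I1; z_ L12; a_ I2; z_ L23; a_ I3]
  end.

(** The Boolean [b s] selects the private neighbour of [s] that carries a
    guard. *)
Definition priv (b : vertex -> bool) (s : vertex) : vertex :=
  match s with a_ i => pa_ i (b s) | c_ i => pc_ i (b s) | _ => s end.

Definition conf_seq (k : kind) (b : vertex -> bool) : seq vertex :=
  [seq priv b s | s <- supports] ++ core k.

Definition conf (k : kind) (b : vertex -> bool) : {set vertex} :=
  [set v in conf_seq k b].

Definition is_private (v : vertex) : bool :=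
  match v with pa_ _ _ | pc_ _ _ => true | _ => false end.

Lemma mem_P v : (v \in P) = is_private v.
Proof.
apply/bigcupP/idP => [[s _]|]; first by rewrite mem_private; case: v.
case: v => // i t _.
  by exists (a_ i); rewrite ?mem_private // inE imset_f.
by exists (c_ i); rewrite ?mem_private // inE imset_f ?orbT.
Qed.

Lemma core_public k v : v \in core k -> ~~ is_private v.
Proof. by move: v; apply/allP; case: k. Qed.

Lemma supports_core k : {subset supports <= core k}.
Proof. by apply/allP; case: k. Qed.

Lemma mem_supports v :
  (v \in supports) = match v with a_ _ | c_ _ => true | _ => false end.
Proof. by case: v => [[]|[]|[]|[]|[]|[]|[] []|[] []]. Qed.

Lemma mem_conf k b v :
  (v \in conf k b) = match v with
    | pa_ i t => b (a_ i) == t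
    | pc_ i t => b (c_ i) == t
    | _ => v \in core k
  end.
Proof.
have public: ~~ is_private v -> (v \in conf k b) = (v \in core k).
  move=> pub_v; rewrite inE mem_cat orb_idl // => /mapP[s].
  by rewrite mem_supports; case: s pub_v => // i + _ v_eq; rewrite v_eq.
have private_in: is_private v ->
    (v \in conf k b) = (v \in [seq priv b s | s <- supports]).
  move=> priv_v; rewrite inE mem_cat orb_idr // => /core_public.
  by rewrite priv_v.
case: v public private_in => [i|i|i|i|i|i|i t|i t] public private_in;
  try exact: public; rewrite private_in //; apply/mapP/eqP.
- by case=> -[] // j _ [-> ->].
- by move=> b_t; exists (a_ i); rewrite ?mem_supports //= b_t.
- by case=> -[] // j _ [-> ->].
- by move=> b_t; exists (c_ i); rewrite ?mem_supports //= b_t.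
Qed.

Lemma conf_uniq k b : uniq (conf_seq k b).
Proof.
rewrite cat_uniq; apply/and3P; split; last by case: k.
- rewrite map_inj_in_uniq // => s t.
  by rewrite !mem_supports; case: s => // i; case: t => // j _ _ [->].
- apply/hasPn=> v /core_public; apply: contra => /mapP[s + ->].
  by rewrite mem_supports; case: s.
Qed.

Lemma card_conf k b : #|conf k b| = 19.
Proof.
rewrite cardsE (card_uniqP (conf_uniq k b)) size_cat size_map.
by case: k.
Qed.

Definition public_vertices : seq vertex :=
  supports ++ [seq q_ i | i <- [:: I1; I2; I3]]
    ++ [seq r_ i | i <- [:: I1; I2; I3]]
    ++ [seq z_ l | l <- labs] ++ [seq u_ l | l <- labs].

Lemma mem_public v : (v \in public_vertices) = ~~ is_private v.
Proof. by case: v => [[]|[]|[]|[]|[]|[]|[] []|[] []]. Qed.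

(** Reduces statements about all non-private vertices to finite checks that
    can be evaluated. *)
Lemma public_ind (p : vertex -> bool) :
  all p public_vertices -> forall v, ~~ is_private v -> p v.
Proof. by move=> /allP p_pub v; rewrite -mem_public; apply: p_pub. Qed.

Lemma core_cover k x y : ~~ is_private x -> ~~ is_private y -> G' x y ->
  (x \in core k) || (y \in core k).
Proof.
move=> pub_x pub_y; apply/implyP.
move: y pub_y; apply: public_ind; move: x pub_x; apply: public_ind.
by case: k; vm_compute.
Qed.

Lemma G'_private_public x y : is_private x -> ~~ is_private y -> G' x y ->
  y \in supports.
Proof.
rewrite mem_supports.
by case: x => // i t _; case: y => // j; rewrite /G' /G /= => _ /and3P[].
Qed.

Lemma conf_cover k b : vertex_cover G' (conf k b).
Proof.
apply/forallP=> x; apply/forallP=> y; apply/implyP=> xy.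
have pub_in v : ~~ is_private v -> (v \in conf k b) = (v \in core k).
  by rewrite mem_conf; case: v.
have [px|pub_x] := boolP (is_private x); last first.
  have [py|pub_y] := boolP (is_private y); last first.
    by rewrite !pub_in // core_cover.
  rewrite pub_in // supports_core //; apply: G'_private_public py pub_x _.
  by rewrite G'_sym.
have [py|pub_y] := boolP (is_private y); last first.
  by rewrite orbC pub_in // supports_core // (G'_private_public px pub_y xy).
move: xy => /and3P[+ _ _]; rewrite !mem_conf.
case: x px => // i t _; case: y py => // j t' _; rewrite /G /= ?orbF //.
  by case/orP=> /andP[/eqP-> ]; case: (b _); case: t; case: t'.
by case/orP=> /andP[/eqP-> ]; case: (b _); case: t; case: t'.
Qed.

Lemma conf_connected k b : connected_set G' (conf k b).
Proof.
apply: (grown_connected G'_sym).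
suff grow t : {subset t <= supports} ->
    grown G' ([seq priv b s | s <- t] ++ core k).
  exact: grow.
elim: t => [_|s t IHt sub_t]; first by case: k; vm_compute.
rewrite /= IHt ?andbT => [|v tv]; last by apply: sub_t; rewrite inE tv orbT.
apply/orP; right; apply/hasP; exists s.
  by rewrite mem_cat supports_core ?orbT // sub_t ?mem_head.
have := sub_t s (mem_head _ _); rewrite mem_supports.
by case: s {sub_t} => // -[] _; rewrite /=; case: (b _).
Qed.

Definition core_set (k : kind) : {set vertex} :=
  match k with
  | KindB => A :|: C :|: R :|: Z'
  | KindC => A :|: C :|: Q :|: U
  | KindD => A :|: C :|: Q :|: U'
  | KindE => A :|: C :|: R :|: Z1
  end.

Lemma core_setE k : [set v in core k] = core_set k.
Proof.
apply/setP=> v; rewrite !inE.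
have mA w : (w \in A) = (if w is a_ _ then true else false).
  by apply/imsetP/idP => [[i _ ->]//|]; case: w => // i _; exists i.
have mC w : (w \in C) = (if w is c_ _ then true else false).
  by apply/imsetP/idP => [[i _ ->]//|]; case: w => // i _; exists i.
have mQ w : (w \in Q) = (if w is q_ _ then true else false).
  by apply/imsetP/idP => [[i _ ->]//|]; case: w => // i _; exists i.
have mR w : (w \in R) = (if w is r_ _ then true else false).
  by apply/imsetP/idP => [[i _ ->]//|]; case: w => // i _; exists i.
have mU w : (w \in U) = (if w is u_ _ then true else false).
  by apply/imsetP/idP => [[i _ ->]//|]; case: w => // i _; exists i.
case: k; rewrite !inE mA mC ?mQ ?mR ?mU;
 by case: v => [[]|[]|[]|[]|[]|[]|[] []|[] []].
Qed.

Lemma conf_type k b : typeBCDE (conf k b).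
Proof.
suff typed: privates_and (core_set k) (conf k b).
  by apply/or4P; case: k typed; constructor.
rewrite -core_setE; apply/andP; split.
  apply/eqP/setP=> v; rewrite in_setD mem_P mem_conf !inE.
  have := @core_public k v; case: v => //= i t.
  - by case: (_ \in core k) => // /(_ isT).
  - by case: (_ \in core k) => // /(_ isT).
apply/forall_inP=> s AC_s; apply/cards1P; exists (priv b s).
apply/setP=> v; rewrite in_setI in_set1 mem_conf mem_private.
have: s \in supports.
  by rewrite mem_supports; case/setUP: AC_s => /imsetP[i _ ->].
rewrite mem_supports; case: s {AC_s} => // i _ /=.
- case: v => [j|j|j|j|l|l|j t|j t]; rewrite ?andbF //.
  by apply/andP/eqP => [[/eqP<- /eqP[->]]|[-> ->]].
- case: v => [j|j|j|j|l|l|j t|j t]; rewrite ?andbF //.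
  by apply/andP/eqP => [[/eqP<- /eqP[->]]|[-> ->]].
Qed.

(** * The responses *)

(** In an attack answered by a plan, the guard that crosses the attacked edge
    goes to a free vertex, so that edge is the last step of a walk. As each
    walk has a single last step, several plans are needed for each pair of
    types. *)
Definition plans (k k' : kind) : seq (seq (seq vertex)) :=
  match k, k' with
  | KindB, KindC => [::
      [:: [:: r_ I1; a_ I1; q_ I1; c_ I1; u_ L12]; [:: r_ I2; u_ L0];
          [:: r_ I3; c_ I3; u_ L13]; [:: z_ L13; q_ I3];
          [:: z_ L23; a_ I2; q_ I2; c_ I2; u_ L23]];
      [:: [:: r_ I1; u_ L13]; [:: r_ I2; u_ L23]; [:: r_ I3; a_ I3; q_ I3];
          [:: z_ L13; a_ I1; q_ I1; c_ I1; u_ L0];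
          [:: z_ L23; q_ I2; c_ I2; u_ L12]];
      [:: [:: r_ I1; u_ L0]; [:: r_ I2; u_ L12]; [:: r_ I3; u_ L23];
          [:: z_ L13; a_ I1; q_ I1; c_ I1; u_ L13]; [:: z_ L23; q_ I3]];
      [:: [:: r_ I1; u_ L12]; [:: r_ I2; u_ L0]; [:: r_ I3; u_ L13];
          [:: z_ L13; a_ I3; q_ I3]; [:: z_ L23; q_ I2; c_ I2; u_ L23]]]
  | KindB, KindD => [::
      [:: [:: r_ I3; c_ I3; u_ L23]; [:: z_ L13; a_ I1; r_ I1; u_ L13];
          [:: z_ L23; a_ I3; q_ I3]];
      [:: [:: r_ I3; u_ L13]; [:: z_ L13; q_ I3];
          [:: z_ L23; a_ I2; r_ I2; u_ L23]];
      [:: [:: r_ I3; u_ L13]; [:: z_ L13; a_ I3; q_ I3];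
          [:: z_ L23; a_ I2; r_ I2; u_ L23]]]
  | KindB, KindE => [::
      [:: [:: q_ I1; c_ I1; r_ I1; a_ I1; z_ L0];
          [:: q_ I2; c_ I2; r_ I2; a_ I2; z_ L12];
          [:: z_ L13; a_ I3; r_ I3; c_ I3; q_ I3]];
      [:: [:: q_ I1; z_ L12]; [:: q_ I2; z_ L0]; [:: z_ L13; q_ I3]];
      [:: [:: q_ I1; z_ L0]; [:: q_ I2; z_ L23; q_ I3];
          [:: z_ L13; a_ I1; z_ L12]];
      [:: [:: q_ I1; z_ L0]; [:: q_ I2; z_ L12]; [:: z_ L13; q_ I3]]]
  | KindC, KindD => [::
      [:: [:: u_ L0; c_ I1; r_ I1]; [:: u_ L12; c_ I2; q_ I2; a_ I2; r_ I2]];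
      [:: [:: u_ L0; r_ I1]; [:: u_ L12; r_ I2]];
      [:: [:: u_ L0; r_ I2]; [:: u_ L12; r_ I1]];
      [:: [:: u_ L0; r_ I2]; [:: u_ L12; c_ I1; r_ I1]]]
  | KindC, KindE => [::
      [:: [:: q_ I1; z_ L0]; [:: q_ I2; a_ I2; z_ L12]; [:: u_ L0; r_ I1];
          [:: u_ L12; c_ I2; r_ I2]; [:: u_ L13; r_ I3];
          [:: u_ L23; c_ I3; q_ I3; a_ I3; z_ L23]];
      [:: [:: q_ I1; a_ I1; z_ L0]; [:: q_ I2; z_ L12];
          [:: u_ L0; c_ I1; r_ I1]; [:: u_ L12; r_ I2];
          [:: u_ L13; c_ I3; q_ I3; z_ L23]; [:: u_ L23; r_ I3]];
      [:: [:: q_ I1; z_ L12]; [:: q_ I2; z_ L0]; [:: u_ L0; r_ I2];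
          [:: u_ L12; c_ I1; r_ I1]; [:: u_ L13; r_ I3];
          [:: u_ L23; c_ I3; q_ I3; z_ L23]];
      [:: [:: q_ I1; a_ I1; z_ L12]; [:: q_ I2; z_ L0]; [:: u_ L0; r_ I2];
          [:: u_ L12; r_ I1]; [:: u_ L13; r_ I3];
          [:: u_ L23; c_ I3; q_ I3; z_ L23]]]
  | KindD, KindE => [::
      [:: [:: q_ I1; z_ L12]; [:: q_ I2; z_ L23];
          [:: u_ L13; c_ I1; r_ I1; a_ I1; z_ L0];
          [:: u_ L23; c_ I3; q_ I3; a_ I3; r_ I3]];
      [:: [:: q_ I1; z_ L12]; [:: q_ I2; z_ L0]; [:: u_ L13; r_ I3];
          [:: u_ L23; c_ I2; r_ I2; a_ I2; z_ L23]];
      [:: [:: q_ I1; z_ L0]; [:: q_ I2; z_ L12]; [:: u_ L13; r_ I3];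
          [:: u_ L23; c_ I3; q_ I3; z_ L23]];
      [:: [:: q_ I1; z_ L0]; [:: q_ I2; z_ L23]; [:: u_ L13; r_ I3];
          [:: u_ L23; r_ I2; a_ I2; z_ L12]];
      [:: [:: q_ I1; z_ L0]; [:: q_ I2; z_ L23];
          [:: u_ L13; r_ I1; a_ I1; z_ L12]; [:: u_ L23; r_ I3]]]
  | _, _ => [::]
  end.

Definition responses (k k' : kind) : seq (seq (seq vertex)) :=
  plans k k' ++ [seq [seq rev w | w <- ws] | ws <- plans k' k].

Lemma responses_carry k k' :
  all (fun ws => carries G' (core k) ws (core k')) (responses k k').
Proof. by case: k; case: k'; vm_compute. Qed.

Definition answers (k : kind) (x y : vertex) (k' : kind) : bool :=
  has (fun ws => relocate ws x == y) (responses k k').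

Lemma responses_answer k x y : x \in core k -> y \notin core k ->
  ~~ is_private y -> G' x y -> has (answers k x y) kinds.
Proof.
move=> kx k'y pub_y xy; apply/implyP: (xy); apply/implyP: (k'y).
move: y pub_y {k'y xy}; apply: public_ind; move: x kx; apply/allP.
by case: k; vm_compute.
Qed.

Definition flip (s : vertex) (b : vertex -> bool) : vertex -> bool :=
  fun v => if v == s then ~~ b v else b v.

Lemma conf_flip k b s : s \in supports ->
  conf k (flip s b) = priv (flip s b) s |: conf k b :\ priv b s.
Proof.
rewrite mem_supports => s_supp; apply/setP=> v.
rewrite (mem_conf k (flip s b)) in_setU1 in_setD1 (mem_conf k b).
case: s s_supp => // i _; case: v => [j|j|j|j|j|j|j t|j t] //; rewrite /flip;
  by case: i; case: j; case: t; rewrite /=; case: (b _).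
Qed.

Definition owner (y : vertex) : vertex :=
  match y with pa_ i _ => a_ i | pc_ i _ => c_ i | _ => y end.

(** The vertex [x] is either [owner y] or the other private neighbour of
    [owner y], which carries a guard since [y] is free. In the first case that
    guard replaces the one leaving [owner y]; in the second it crosses. *)
Lemma respond_private k b x y : x \in conf k b -> y \notin conf k b ->
  is_private y -> G' x y ->
  legal_response G' (conf k b) (x, y) (conf k (flip (owner y) b)).
Proof.
move=> kx k'y priv_y xy; set s := owner y.
have s_supp: s \in supports.
  by rewrite mem_supports /s; case: y priv_y {k'y xy s}.
have y_eq: y = priv (flip s b) s.
  rewrite /s /flip; case: y priv_y k'y {xy s s_supp} => // i t _;
    by rewrite mem_conf /= eqxx; case: (b _); case: t.
have s_in: s \in conf k b.
  have := supports_core k s_supp; rewrite mem_conf.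
  by move: s_supp; rewrite mem_supports; case: (s).
have priv_in b' : priv b' s \in private s.
  by move: s_supp; rewrite mem_supports mem_private; case: (s) => //= i _.
have w_in: priv b s \in conf k b.
  by move: s_supp; rewrite mem_supports mem_conf; case: (s) => //= i _.
rewrite conf_flip // -y_eq; apply: legal_push => //.
have yx: G' y x by rewrite G'_sym.
have y_in: y \in private s by rewrite y_eq.
case: (G'_private y_in yx) => [->|x_in].
  right; move: s_supp; rewrite mem_supports.
  by case: (s) => // -[] _; rewrite /=; case: (b _).
left; move: kx s_supp x_in; rewrite mem_conf mem_supports mem_private.
case: x {xy yx} => // i t;
  case: s {y_eq y_in priv_in w_in s_in} => // j /eqP bt;
  by move=> _ /eqP[->]; rewrite /= bt.
Qed.

Lemma respond_out k b x y : x \in conf k b -> y \notin conf k b -> G' x y ->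
  {kb | legal_response G' (conf k b) (x, y) (conf kb.1 kb.2)}.
Proof.
move=> kx k'y xy; have [priv_y|pub_y] := boolP (is_private y).
  by exists (k, flip (owner y) b); apply: respond_private.
have k''y: y \notin core k by move: k'y; rewrite mem_conf; case: y pub_y {xy}.
have kcx: x \in core k.
  have [priv_x|pub_x] := boolP (is_private x); last first.
    by move: kx; rewrite mem_conf; case: x pub_x {xy}.
  by rewrite (supports_core k (G'_private_public priv_x pub_y xy)) in k''y.
have answered := responses_answer kcx k''y pub_y xy.
pose k' := nth k kinds (find (answers k x y) kinds).
exists (k', b).
have := nth_find k answered; rewrite -/k' => /hasP[ws ws_in /eqP<-].
have := allP (responses_carry k k') ws ws_in => carry.
exact: legal_walks (conf_uniq k b) (conf_uniq k' b) carry kcx.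
Qed.

Lemma respond k b x y : G' x y ->
  {kb | legal_response G' (conf k b) (x, y) (conf kb.1 kb.2)}.
Proof.
move=> xy.
have [kx|k'x] := boolP (x \in conf k b);
  have [ky|k'y] := boolP (y \in conf k b).
- by exists (k, b); apply: legal_swap G'_sym kx ky xy.
- exact: respond_out.
- have [kb resp] := respond_out ky k'x (etrans (G'_sym y x) xy).
  by exists kb; apply: legal_response_sym.
have /forallP/(_ x)/forallP/(_ y)/implyP/(_ xy) := conf_cover k b.
by rewrite (negPf k'x) (negPf k'y).
Qed.

Theorem lemma13 :
  exists k : nat,
    [/\ is_cvc G' k, is_ecvc G' k & defensible_within G' k typeBCDE].
Proof.
have cvc_conf k b : connected_vertex_cover G' (conf k b).
  by rewrite /connected_vertex_cover conf_cover conf_connected.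
have def19 (F : pred {set vertex}) :
    (forall k b, F (conf k b)) -> defensible_within G' 19 F.
  move=> Fconf.
  apply: (@defensible_within_states _ _ _ (fun kb => conf kb.1 kb.2)
            (KindB, fun=> false)) => [[k b]|[k b] x y].
    by split; [exact: card_conf | exact: cvc_conf | exact: Fconf].
  exact: respond.
exists 19; split.
- split; last exact: cvc_ge.
  by exists (conf KindB (fun=> false)); rewrite card_conf.
- split; first exact: def19.
  by move=> k' [s [[<- cvc_s _] _]]; apply: cvc_ge.
- by apply: def19; exact: conf_type.
Qed.
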